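(* Let $G$ be a connected graph. Then $G$ has a normal spanning tree if and only if its vertex set $V(G)$ is a countable union of $TK^{\aleph_0}$-dispersed sets, i.e.\ there exist sets $V_n \subseteq V(G)$, $n \in \mathbb{N}$, with $V(G) = \bigcup_{n \in \mathbb{N}} V_n$, such that each $V_n$ is $TK^{\aleph_0}$-dispersed in $G$.
   Context: Graphs may be infinite (of arbitrary cardinality). For a tree $T$ with root $r$, the tree-order $\leq_T$ is defined by $u \leq_T v$ if $u$ lies on the unique path from $r$ to $v$ in $T$. A rooted spanning tree $T$ of $G$ is normal if the end vertices of every edge of $G$ are comparable in $\leq_T$. A subdivided infinite clique in $G$ is a subgraph of $G$ that is a subdivision of the complete graph on countably infinitely many vertices. A set $U \subseteq V(G)$ is $TK^{\aleph_0}$-dispersed in $G$ if for every subdivided infinite clique $K \subseteq G$ there is a finite set $F \subseteq V(G)$ separating $U$ from $K$ (i.e.\ every path in $G$ from $U$ to $K$ meets $F$). *)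

(* Defs.v *)
(* graphs of arbitrary cardinality as a symmetric irreflexive
   relation on an arbitrary Type. *)
From Stdlib Require Import List.
Import ListNotations.
Set Implicit Arguments.

Section Graphs.
Variable V : Type.

Fixpoint chain (e : V -> V -> Prop) (l : list V) : Prop :=
  match l with
  | x :: ((y :: _) as l') => e x y /\ chain e l'
  | _ => True
  end.

Definition is_path (e : V -> V -> Prop) (a b : V) (p : list V) : Prop :=
  NoDup p /\ chain e p /\ hd_error p = Some a /\ last p a = b.

Definition connected (e : V -> V -> Prop) : Prop :=
  (exists v : V, True) /\ forall a b : V, exists p, is_path e a b p.

Definition is_cycle (e : V -> V -> Prop) (c : list V) : Prop :=
  3 <= length c /\ NoDup c /\ chain e c /\
  exists x y, hd_error c = Some x /\ last c x = y /\ e y x.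

Definition acyclic (e : V -> V -> Prop) : Prop :=
  forall c, ~ is_cycle e c.

Definition spanning_tree (adj t : V -> V -> Prop) : Prop :=
  (forall x y, t x y -> adj x y) /\ (forall x y, t x y -> t y x) /\
  connected t /\ acyclic t.

Definition tree_le (t : V -> V -> Prop) (r u v : V) : Prop :=
  exists p, is_path t r v p /\ In u p.

Definition normal_spanning_tree (adj t : V -> V -> Prop) (r : V) : Prop :=
  spanning_tree adj t /\
  forall x y, adj x y -> tree_le t r x y \/ tree_le t r y x.

Definition has_normal_spanning_tree (adj : V -> V -> Prop) : Prop :=
  exists t r, normal_spanning_tree adj t r.

(* K (as a vertex set) is the vertex set of a subdivided infinite clique in G:
   injective branch vertices b i (i : nat), paths P i j (i < j) in G from b i
   to b j, internally disjoint and avoiding other branch vertices internally. *)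
Definition subdivided_inf_clique (adj : V -> V -> Prop) (K : V -> Prop) : Prop :=
  exists (b : nat -> V) (P : nat -> nat -> list V),
    (forall i j, b i = b j -> i = j) /\
    (forall i j, i < j -> is_path adj (b i) (b j) (P i j)) /\
    (forall i j m, i < j -> In (b m) (P i j) -> m = i \/ m = j) /\
    (forall i j k l x, i < j -> k < l -> (i, j) <> (k, l) ->
        In x (P i j) -> In x (P k l) ->
        (x = b i \/ x = b j) /\ (x = b k \/ x = b l)) /\
    (forall x, K x <-> exists i j, i < j /\ In x (P i j)).

Definition separates (adj : V -> V -> Prop) (F : list V) (U K : V -> Prop) : Prop :=
  forall a c p, U a -> K c -> is_path adj a c p -> exists f, In f F /\ In f p.

Definition TK_dispersed (adj : V -> V -> Prop) (U : V -> Prop) : Prop :=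
  forall K, subdivided_inf_clique adj K ->
    exists F : list V, separates adj F U K.

End Graphs.

(* Main.v *)
Require Import Defs.
From Stdlib Require Import List Permutation Arith Lia Cantor.
From Stdlib Require Import Classical ClassicalEpsilon FunctionalExtensionality PropExtensionality.
Import ListNotations.
Set Implicit Arguments.

(** Given a normal spanning tree, its levels are dispersed: as finitely many vertices cannot
    separate two branch vertices of a subdivided clique, for each [n] there is a vertex [x] of level
    [n + 1] comparable to all branch vertices, and the vertices below [x], together with the
    finitely many clique paths leaving the up-set of [x], separate the clique from level [n].

    Conversely, let [V] be the union of dispersed sets [Vn]. Grow normal trees [T_0, T_1, ...]: for
    every component [D] of [G - T_n] add a path in [D] hanging from the largest neighbour of [D] in
    [T_n] and ending at a target. The targets are scheduled so that, as long as [D] contains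
    vertices of [Vn k], or neighbours of a given tree vertex [x], one of those is reached infinitely
    often. If a component [C] of the complement of the union survives, then its neighbourhood is
    infinite (else [C] would be a component of some [G - T_n] and the tree would have grown into
    it), and the disjoint, consecutively linked paths [P_n] grown in the components containing [C]
    connect any two neighbours of [C] even after the removal of finitely many vertices. Hence there
    is a subdivided clique with branch vertices in the neighbourhood of [C], which no finite set
    separates from the [P_n], nor therefore from any [Vn k] that meets [C]. *)

(** * Walks and paths *)

Section Walks.
Variable V : Type.
Variable e : V -> V -> Prop.

(** Walks rather than paths: they concatenate without any disjointness, and [reach_path] shortens
    them to paths inside the same set. *)
Inductive reach (A : V -> Prop) : V -> V -> Prop :=
| reach_refl x : A x -> reach A x x
| reach_cons x y z : A x -> e x y -> reach A y z -> reach A x z.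

Lemma reach_left A x y : reach A x y -> A x.
Proof. now destruct 1. Qed.

Lemma reach_right A x y : reach A x y -> A y.
Proof. now induction 1. Qed.

Lemma reach_trans A x y z : reach A x y -> reach A y z -> reach A x z.
Proof. induction 1; eauto using reach_cons. Qed.

Lemma reach_snoc A x y z : reach A x y -> e y z -> A z -> reach A x z.
Proof.
  intros H He Hz. apply reach_trans with y; [exact H|].
  apply reach_cons with z; [eapply reach_right; eauto|exact He|now apply reach_refl].
Qed.

Lemma reach_sub (A B : V -> Prop) x y :
  (forall z, A z -> B z) -> reach A x y -> reach B x y.
Proof. intros AB; induction 1; eauto using reach_refl, reach_cons. Qed.

Lemma reach_sym A x y :
  (forall a b, e a b -> e b a) -> reach A x y -> reach A y x.
Proof. intros es; induction 1; eauto using reach_refl, reach_snoc. Qed.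

Lemma reach_exit (A B : V -> Prop) x w :
  reach A x w -> B x -> ~ B w ->
  exists y z, reach (fun v => A v /\ B v) x y /\ e y z /\ A z /\ ~ B z.
Proof.
  induction 1 as [x Ax|x y w Ax xy yw IH]; intros Bx Bw; [contradiction|].
  destruct (classic (B y)) as [By|By].
  - destruct (IH By Bw) as (u & z & H1 & H2); exists u, z; split; [|easy].
    now apply reach_cons with y.
  - exists x, y; repeat split; auto.
    + now apply reach_refl.
    + eapply reach_left; eauto.
Qed.

Lemma reach_invariant (A B : V -> Prop) x y :
  (forall u v, e u v -> B u -> A v -> B v) -> reach A x y -> B x -> B y.
Proof.
  intros inv; induction 1 as [|x y z Ax xy yz IH]; auto.
  intros Bx; apply IH; apply inv with x; auto. eapply reach_left; eauto.
Qed.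

Lemma chain_reach (A : V -> Prop) x l :
  chain e (x :: l) -> (forall z, In z (x :: l) -> A z) ->
  forall y, In y (x :: l) -> reach A x y.
Proof.
  revert x; induction l as [|u l IH]; intros x.
  - intros _ HA y [<-|[]]; apply reach_refl; apply HA; now left.
  - intros [xu C] HA y [<-|Hy]; [apply reach_refl; apply HA; now left|].
    apply reach_cons with u; auto; [apply HA; now left|].
    apply IH; auto. intros z Hz; apply HA; now right.
Qed.

Lemma chain_app_r l l' : chain e (l ++ l') -> chain e l'.
Proof.
  induction l as [|x l IH]; auto; intros H; apply IH.
  simpl in H; destruct (l ++ l'); simpl; tauto.
Qed.

Lemma chain_app_l l l' : chain e (l ++ l') -> chain e l.
Proof.
  induction l as [|x l IH]; simpl; auto; intros H.
  destruct l as [|y l]; simpl; auto.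
  destruct H as [H1 H2]; split; [exact H1|]. now apply IH.
Qed.

Lemma chain_app l x l' : chain e (l ++ [x]) -> chain e (x :: l') -> chain e (l ++ x :: l').
Proof.
  intros H1 H2; induction l as [|y l IH]; auto.
  destruct l as [|z l]; [split; [apply H1|exact H2]|].
  destruct H1 as [H1 H1']; split; [exact H1|]. now apply IH.
Qed.

Lemma chain_rev l : (forall a b, e a b -> e b a) -> chain e l -> chain e (rev l).
Proof.
  intros es; induction l as [|x l IH]; simpl; auto.
  destruct l as [|y l]; simpl; auto.
  intros [xy H]. specialize (IH H). simpl in IH.
  rewrite <- app_assoc; simpl. apply chain_app; [exact IH|]; simpl; auto.
Qed.

Lemma last_irrel (l : list V) a b : l <> [] -> last l a = last l b.
Proof.
  induction l as [|x l IH]; [easy|]. destruct l; auto. intros _; now apply IH.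
Qed.

Lemma last_app_cons (l l' : list V) x a : last (l ++ x :: l') a = last (x :: l') a.
Proof.
  induction l as [|y l IH]; auto. simpl app.
  rewrite <- IH. destruct l; auto.
Qed.

Lemma last_in (l : list V) a : l <> [] -> In (last l a) l.
Proof.
  intros Hl; destruct (exists_last Hl) as (l' & x & ->).
  rewrite last_last. apply in_or_app; right; now left.
Qed.

Lemma path_nil x : is_path e x x [x].
Proof. repeat split; simpl; auto. constructor; [easy|constructor]. Qed.

Lemma path_inv a b p : is_path e a b p -> exists l, p = a :: l.
Proof.
  intros (_ & _ & H & _). destruct p as [|x p]; [easy|].
  injection H as ->. now exists p.
Qed.

Lemma path_head_in a b p : is_path e a b p -> In a p.
Proof. intros H; destruct (path_inv H) as [l ->]; now left. Qed.

Lemma path_last_in a b p : is_path e a b p -> In b p.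
Proof.
  intros H; destruct (path_inv H) as [l ->]. destruct H as (_ & _ & _ & <-).
  now apply last_in.
Qed.

Lemma path_suffix a b l x l' : is_path e a b (l ++ x :: l') -> is_path e x b (x :: l').
Proof.
  intros (N & C & _ & L); repeat split.
  - now apply NoDup_app_remove_l in N.
  - now apply chain_app_r in C.
  - rewrite <- L, last_app_cons. now apply last_irrel.
Qed.

Lemma path_prefix a b l x l' : is_path e a b (l ++ x :: l') -> is_path e a x (l ++ [x]).
Proof.
  intros (N & C & H & L).
  change (x :: l') with ([x] ++ l') in *. rewrite app_assoc in *.
  repeat split.
  - now apply NoDup_app_remove_r in N.
  - now apply chain_app_l in C.
  - destruct l; exact H.
  - now rewrite last_app_cons.
Qed.

Lemma path_cons a b c p :
  e a b -> is_path e b c p -> ~ In a p -> is_path e a c (a :: p).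
Proof.
  intros ab H Ha; destruct (path_inv H) as [l ->].
  destruct H as (N & C & _ & L); repeat split; auto.
  - now constructor.
  - rewrite <- L. exact (@last_irrel (b :: l) a b ltac:(easy)).
Qed.

Lemma reach_path A x y :
  reach A x y -> exists p, is_path e x y p /\ forall z, In z p -> A z.
Proof.
  induction 1 as [x Ax|x y z Ax xy yz (p & Hp & HA)].
  - exists [x]; split; [apply path_nil|]. now intros z [<-|[]].
  - destruct (classic (In x p)) as [Hx|Hx].
    + apply in_split in Hx as (l & l' & ->).
      exists (x :: l'); split; [eapply path_suffix; eauto|].
      intros w Hw; apply HA; apply in_or_app; now right.
    + exists (x :: p); split; [now apply path_cons with y|].
      intros w [<-|Hw]; auto.
Qed.

Lemma path_reach (A : V -> Prop) x y p :
  is_path e x y p -> (forall z, In z p -> A z) -> reach A x y.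
Proof.
  intros H HA. assert (In y p) by (eapply path_last_in; eauto).
  destruct (path_inv H) as [l ->]. destruct H as (_ & C & _).
  now apply chain_reach with (l := l).
Qed.

Lemma path_loop x p : is_path e x x p -> p = [x].
Proof.
  intros H; destruct (path_inv H) as [l ->].
  destruct H as (N & _ & _ & L). destruct l as [|y l]; auto.
  exfalso. inversion_clear N as [|? ? Nx _]. apply Nx. rewrite <- L at 1.
  exact (@last_in (y :: l) x ltac:(easy)).
Qed.

(* Two paths that part at [a] would close up to a cycle through [a]. *)
Lemma path_unique a b p q :
  (forall x y, e x y -> e y x) -> acyclic e ->
  is_path e a b p -> is_path e a b q -> p = q.
Proof.
  intros es ac; revert a q; induction p as [|a' p IH]; intros a q Hp Hq.
  - destruct Hp as (_ & _ & H & _); easy.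
  - destruct (path_inv Hp) as [l E]; injection E as -> <-.
    destruct (path_inv Hq) as [q' ->]. f_equal.
    destruct p as [|x p].
    + assert (a = b) as <- by (destruct Hp as (_ & _ & _ & L); exact L).
      apply path_loop in Hq. injection Hq; auto.
    + destruct q' as [|y q'].
      * assert (a = b) as <- by (destruct Hq as (_ & _ & _ & L); exact L).
        apply path_loop in Hp. injection Hp; auto.
      * assert (Px : is_path e x b (x :: p)) by exact (path_suffix [a] x p Hp).
        assert (Py : is_path e y b (y :: q')) by exact (path_suffix [a] y q' Hq).
        destruct (classic (x = y)) as [->|xy]; [now apply IH with y|].
        exfalso.
        destruct Hp as (Np & (ax & Cp) & _), Hq as (Nq & (ay & Cq) & _).
        inversion_clear Np as [|? ? Nx _]. inversion_clear Nq as [|? ? Ny _].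
        assert (R : reach (fun z => z <> a) x y).
        { apply reach_trans with b.
          - apply path_reach with (x :: p); auto. now intros z Hz ->.
          - apply reach_sym; auto. apply path_reach with (y :: q'); auto.
            now intros z Hz ->. }
        destruct (reach_path R) as (w & Hw & Aw).
        assert (Hc : is_path e a y (a :: w)).
        { apply path_cons with x; auto. intros Ha; now apply (Aw a Ha). }
        apply (ac (a :: w)). split; [|split; [apply Hc|split; [apply Hc|]]].
        -- destruct (path_inv Hw) as [w' ->]. destruct w' as [|z w']; simpl; [|lia].
           destruct Hw as (_ & _ & _ & L). now elim xy.
        -- exists a, y; split; [easy|split; [apply Hc|auto]].
Qed.

End Walks.

(** * Recursive choices and finite bounds *)

Section History.
Variable A : Type.

Lemma history_choice (R : list A -> A -> Prop) :
  (forall h, exists a, R h a) ->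
  exists f : nat -> A, forall n, R (map f (seq 0 n)) (f n).
Proof.
  intros H.
  destruct (choice (fun h a => R h a) H) as [g Hg].
  set (hist := fix hist n := match n with O => [] | S n => hist n ++ [g (hist n)] end).
  exists (fun n => g (hist n)); intros n.
  assert (E : map (fun n => g (hist n)) (seq 0 n) = hist n).
  { induction n as [|n IH]; auto. rewrite seq_S, map_app, IH; reflexivity. }
  rewrite E; apply Hg.
Qed.

Lemma finite_cover (B : Type) (R : B -> A -> Prop) :
  (forall b, exists l, forall a, R b a -> In a l) ->
  forall L, exists l, forall b a, In b L -> R b a -> In a l.
Proof.
  intros H L; destruct (choice _ H) as [g Hg].
  exists (flat_map g L); intros b a Hb Hab. apply in_flat_map; eauto.
Qed.

Lemma eventually_list (Q : nat -> A -> Prop) (l : list A) :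
  (forall a, In a l -> exists N, forall n, N <= n -> Q n a) ->
  exists N, forall n a, N <= n -> In a l -> Q n a.
Proof.
  induction l as [|a l IH]; intros H.
  - exists 0; intros n a _ [].
  - destruct (H a (or_introl eq_refl)) as [N1 H1].
    destruct IH as [N2 H2]; [intros b Hb; apply H; now right|].
    exists (N1 + N2); intros n b Hn [<-|Hb]; [apply H1|apply H2]; auto; lia.
Qed.

Lemma NoDup_app_disjoint (l l' : list A) :
  NoDup (l ++ l') -> forall a, In a l -> In a l' -> False.
Proof.
  intros N a H1 H2. apply in_split in H1 as (l1 & l2 & ->).
  rewrite <- app_assoc in N. apply NoDup_remove_2 in N. apply N.
  apply in_or_app; right. apply in_or_app; now right.
Qed.

End History.

(** * Subdivided cliques from infinitely connected sets *)

Section Cliques.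
Variable V : Type.
Variable adj : V -> V -> Prop.

(** The paths are chosen one after the other, each avoiding [S] and all earlier paths except in its
    ends. As [y] is not in [S], only [x i] remains as a common vertex with [S]. *)
Lemma disjoint_fan (X : V -> Prop) (S : list V) (y : V) (n : nat) (x : nat -> V) :
  (forall a b S, X a -> X b -> a <> b ->
    exists p, is_path adj a b p /\ forall z, In z p -> In z S -> z = a \/ z = b) ->
  X y -> ~ In y S -> (forall i, i < n -> X (x i) /\ In (x i) S) ->
  exists p : nat -> list V, forall i, i < n ->
    is_path adj (x i) y (p i) /\
    (forall z, In z (p i) -> In z S -> z = x i) /\
    (forall k z, k < i -> In z (p k) -> In z (p i) -> z = x i \/ z = y).
Proof.
  intros conn Xy yS Hx.
  destruct (history_choice (fun (h : list (list V)) p => length h < n ->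
     is_path adj (x (length h)) y p /\
     forall z, In z p -> In z (S ++ concat h) -> z = x (length h) \/ z = y)) as [p Hp].
  { intros h. destruct (classic (length h < n)) as [Hh|Hh]; [|exists []; easy].
    destruct (Hx _ Hh) as [H1 H2].
    destruct (conn (x (length h)) y (S ++ concat h)) as (p & Hp); auto.
    - now intros <-.
    - now exists p. }
  exists p; intros i Hi. specialize (Hp i). rewrite length_map, length_seq in Hp.
  destruct (Hp Hi) as [H1 H2]; split; [exact H1|split].
  - intros z Hz HS. destruct (H2 z Hz) as [->| ->]; auto; [|contradiction].
    apply in_or_app; now left.
  - intros k z Hk Hzk Hzi. apply H2; auto. apply in_or_app; right.
    apply in_concat. exists (p k); split; auto. apply in_map. apply in_seq; lia.
Qed.

(** Branch vertices are chosen one at a time, each outside everything used so far and together with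
    a fan of paths from the earlier ones. *)
Lemma infinitely_connected_clique (X : V -> Prop) :
  (forall l : list V, exists x, X x /\ ~ In x l) ->
  (forall a b S, X a -> X b -> a <> b ->
    exists p, is_path adj a b p /\ forall z, In z p -> In z S -> z = a \/ z = b) ->
  exists K (b : nat -> V), subdivided_inf_clique adj K /\
    (forall i j, b i = b j -> i = j) /\ forall i, X (b i) /\ K (b i).
Proof.
  intros inf conn.
  destruct (inf []) as (x0 & Xx0 & _).
  pose (item := (V * (nat -> list V))%type).
  (* Entries are also evaluated at indices beyond their fans; those arbitrary lists merely enlarge
     the finite set to be avoided. *)
  pose (used := fun h : list item =>
    flat_map (fun a => fst a :: flat_map (snd a) (seq 0 (length h))) h).
  destruct (history_choice (fun (h : list item) a =>
     (forall a', In a' h -> X (fst a')) ->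
     X (fst a) /\ ~ In (fst a) (used h) /\
     forall i, i < length h ->
       is_path adj (nth i (map fst h) x0) (fst a) (snd a i) /\
       (forall z, In z (snd a i) -> In z (used h) -> z = nth i (map fst h) x0) /\
       (forall k z, k < i -> In z (snd a k) -> In z (snd a i) ->
          z = nth i (map fst h) x0 \/ z = fst a))) as [f Hf].
  { intros h. destruct (classic (forall a', In a' h -> X (fst a'))) as [Hh|Hh];
      [|exists (x0, fun _ => []); easy].
    destruct (inf (used h)) as (y & Xy & Hy).
    destruct (@disjoint_fan X (used h) y (length h) (fun i => nth i (map fst h) x0))
      as [p Hp]; auto.
    { intros i Hi.
      assert (H : In (nth i (map fst h) x0) (map fst h)) by (apply nth_In; now rewrite length_map).
      apply in_map_iff in H as (a & E & Ha). rewrite <- E; split; auto.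
      apply in_flat_map; exists a; split; auto. now left. }
    exists (y, p); intros _; auto. }
  pose (b := fun n => fst (f n)). pose (P := fun i j => snd (f j) i).
  assert (XB : forall n, X (b n)).
  { intros n; induction n as [n IH] using lt_wf_ind. apply (Hf n).
    intros a' Ha. apply in_map_iff in Ha as (k & <- & Hk). apply in_seq in Hk. apply IH; lia. }
  assert (nthb : forall i n, i < n -> nth i (map fst (map f (seq 0 n))) x0 = b i).
  { intros i n Hi. rewrite map_map.
    rewrite nth_indep with (d' := fst (f 0)) by (now rewrite length_map, length_seq).
    rewrite map_nth with (f := fun x => fst (f x)). rewrite seq_nth; auto. }
  pose (U := fun n => used (map f (seq 0 n))).
  assert (HU : forall n, ~ In (b n) (U n) /\ forall i, i < n ->
       is_path adj (b i) (b n) (P i n) /\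
       (forall z, In z (P i n) -> In z (U n) -> z = b i) /\
       (forall k z, k < i -> In z (P k n) -> In z (P i n) -> z = b i \/ z = b n)).
  { intros n. destruct (Hf n) as (_ & H1 & H2).
    - intros a' Ha. apply in_map_iff in Ha as (k & <- & _). apply XB.
    - split; [exact H1|]. intros i Hi. specialize (H2 i).
      rewrite length_map, length_seq, nthb in H2; auto. }
  assert (bU : forall i n, i < n -> In (b i) (U n)).
  { intros i n Hi. apply in_flat_map. exists (f i); split; [|now left].
    apply in_map; apply in_seq; lia. }
  assert (PU : forall i j n z, i < j < n -> In z (P i j) -> In z (U n)).
  { intros i j n z Hij Hz. apply in_flat_map. exists (f j); split.
    - apply in_map; apply in_seq; lia.
    - right. apply in_flat_map. exists i; split; auto.
      rewrite length_map, length_seq. apply in_seq; lia. }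
  assert (binj : forall i j, b i = b j -> i = j).
  { intros i j E. destruct (lt_eq_lt_dec i j) as [[H|H]|H]; auto; exfalso.
    - apply (HU j). rewrite <- E. now apply bU.
    - apply (HU i). rewrite E. now apply bU. }
  assert (bP : forall i j m, i < j -> In (b m) (P i j) -> m = i \/ m = j).
  { intros i j m Hij Hm. destruct (lt_eq_lt_dec m j) as [[H|H]|H]; auto.
    - left; apply binj. destruct (HU j) as [_ H1]. destruct (H1 i Hij) as (_ & H2 & _).
      apply H2; auto.
    - exfalso. apply (HU m). now apply PU with i j. }
  (* For different last ends, the later path meets what was used before only in its start. *)
  assert (dis : forall i j k l x, i < j -> k < l -> j < l ->
        In x (P i j) -> In x (P k l) -> x = b k /\ (x = b i \/ x = b j)).
  { intros i j k l x Hij Hkl Hjl H1 H2.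
    assert (E : x = b k).
    { destruct (HU l) as [_ H3]. apply (H3 k Hkl); auto. now apply PU with i j. }
    split; auto. subst x. destruct (bP i j k) as [->| ->]; auto. }
  (* Two paths with the same last end belong to one fan; [bP] rules out [b k] as a common vertex. *)
  assert (dis' : forall i k j x, i < k -> k < j -> In x (P i j) -> In x (P k j) -> x = b j).
  { intros i k j x Hik Hkj H1 H2. destruct (HU j) as [_ H3].
    destruct (H3 k Hkj) as (_ & _ & H4). destruct (H4 i x Hik H1 H2); auto. subst x.
    destruct (bP i j k) as [->| ->]; auto; lia. }
  exists (fun x => exists i j, i < j /\ In x (P i j)), b; split; [|split; auto].
  - exists b, P. split; [exact binj|]. split; [intros i j Hij; apply (HU j); auto|].
    split; [exact bP|]. split; [|easy].
    intros i j k l x Hij Hkl ne H1 H2.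
    destruct (lt_eq_lt_dec j l) as [[Hjl|E]|Hjl].
    + destruct (dis i j k l x); auto.
    + subst l. assert (E : x = b j); [|auto].
      destruct (lt_eq_lt_dec i k) as [[Hik|E]|Hik].
      * now apply dis' with i k.
      * subst; congruence.
      * now apply dis' with k i.
    + destruct (dis k l i j x); auto.
  - intros i; split; auto. exists i, (S i); split; auto.
    eapply path_head_in. apply (HU (S i)); auto.
Qed.

End Cliques.

(** * The tree-order *)

Section Trees.
Variable V : Type.
Variable adj : V -> V -> Prop.
Hypothesis adj_sym : forall x y, adj x y -> adj y x.

(* A tree rooted at [r] is given by the map [d] sending each of its vertices [v] to the list
   [v; ...; r] of the vertices below [v], and every other vertex to [[]]. Thus [In u (d v)] is
   the tree-order. *)
Definition tree (r : V) (d : V -> list V) : Prop :=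
  d r = [r] /\
  forall v, d v <> [] -> v = r \/ exists u, adj v u /\ d u <> [] /\ d v = v :: d u.

Section TreeOrder.
Variables (r : V) (d : V -> list V).
Hypothesis Hd : tree r d.

Lemma tree_ind (Q : V -> Prop) :
  Q r ->
  (forall v u, adj v u -> d u <> [] -> d v = v :: d u -> Q u -> Q v) ->
  forall v, d v <> [] -> Q v.
Proof.
  intros Qr Qs v. remember (length (d v)) as n eqn:E. revert v E.
  induction n as [n IH] using lt_wf_ind; intros v -> Hv.
  destruct (proj2 Hd v Hv) as [->|(u & vu & Hu & E)]; auto.
  apply Qs with u; auto. apply (IH (length (d u))); auto. rewrite E; simpl; lia.
Qed.

Lemma tree_head v : d v <> [] -> exists l, d v = v :: l.
Proof.
  intros Hv. destruct (proj2 Hd v Hv) as [->|(u & _ & _ & ->)]; eauto.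
  exists []; apply Hd.
Qed.

Lemma tree_refl v : d v <> [] -> In v (d v).
Proof. intros Hv; destruct (tree_head Hv) as [l ->]; now left. Qed.

Lemma tree_inj u v : d u <> [] -> d u = d v -> u = v.
Proof.
  intros Hu E. destruct (tree_head Hu) as [l E1].
  assert (Hv : d v <> []) by congruence.
  destruct (tree_head Hv) as [l' E2]. congruence.
Qed.

Lemma tree_suffix x v : In x (d v) -> d x <> [] /\ exists l, d v = l ++ d x.
Proof.
  intros Hx. assert (Hv : d v <> []) by (now intros E; rewrite E in Hx).
  revert Hx. pattern v; revert v Hv. apply tree_ind.
  - rewrite (proj1 Hd). intros [<-|[]]. rewrite (proj1 Hd). split; [easy|now exists []].
  - intros v u vu Hu E IH. rewrite E. intros [<-|Hx].
    + rewrite E; split; [easy|now exists []].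
    + destruct (IH Hx) as [H [l ->]]; split; auto. now exists (v :: l).
Qed.

Lemma tree_trans x y v : In x (d y) -> In y (d v) -> In x (d v).
Proof.
  intros Hx Hy. destruct (tree_suffix _ _ Hy) as [_ [l ->]]. apply in_or_app; now right.
Qed.

Lemma tree_comparable x y v : In x (d v) -> In y (d v) -> In x (d y) \/ In y (d x).
Proof.
  intros Hx. assert (Hv : d v <> []) by (now intros E; rewrite E in Hx).
  revert Hx. pattern v; revert v Hv. apply tree_ind.
  - rewrite (proj1 Hd). intros [<-|[]] [<-|[]]. rewrite (proj1 Hd). left; now left.
  - intros v u vu Hu E IH. rewrite E. intros [<-|Hx] [<-|Hy]; auto.
    + left; rewrite E; now left.
    + right; rewrite E; now right.
    + left; rewrite E; now right.
Qed.

Lemma tree_level_inj x y v :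
  In x (d v) -> In y (d v) -> length (d x) = length (d y) -> x = y.
Proof.
  assert (H : forall x y, In x (d y) -> length (d x) = length (d y) -> x = y).
  { clear x y v; intros x y Hx E. destruct (tree_suffix _ _ Hx) as [Hnx [l El]].
    apply tree_inj; auto. rewrite El in *. rewrite length_app in E.
    destruct l; auto. simpl in E; lia. }
  intros Hx Hy E. destruct (tree_comparable _ _ _ Hx Hy); [|symmetry]; auto.
Qed.

Lemma tree_NoDup v : NoDup (d v).
Proof.
  destruct (classic (d v = [])) as [->|Hv]; [constructor|].
  pattern v; revert v Hv. apply tree_ind.
  - rewrite (proj1 Hd). repeat constructor; auto.
  - intros v u vu Hu E IH. rewrite E; constructor; auto.
    intros Hi. destruct (tree_suffix _ _ Hi) as [_ [l El]].
    assert (length (d u) = length (l ++ d v)) by congruence.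
    rewrite length_app, E in H; simpl in H; lia.
Qed.

Lemma tree_root v : d v <> [] -> In r (d v).
Proof.
  revert v; apply tree_ind.
  - rewrite (proj1 Hd); now left.
  - intros v u _ _ -> H; now right.
Qed.

Lemma tree_child x v :
  In x (d v) -> v <> x -> exists c, d c = c :: d x /\ In c (d v).
Proof.
  intros Hx. assert (Hv : d v <> []) by (now intros E; rewrite E in Hx).
  revert Hx. pattern v; revert v Hv. apply tree_ind.
  - rewrite (proj1 Hd). intros [<-|[]]; easy.
  - intros v u vu Hu E IH Hx Hvx. rewrite E in Hx |- *.
    destruct Hx as [Hx|Hx]; [easy|].
    destruct (classic (u = x)) as [<-|Hux].
    + exists v; split; auto; now left.
    + destruct (IH Hx Hux) as (c & H1 & H2). exists c; split; auto; now right.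
Qed.

(** If [b] is below [a], then [x] and [b] are both below [a] and hence comparable. So edges leave
    the up-set of [x] only into [d x]. *)
Lemma tree_up_closed x a b :
  (forall u v, adj u v -> In u (d v) \/ In v (d u)) ->
  adj a b -> In x (d a) -> In x (d b) \/ In b (d x).
Proof.
  intros nrm ab Hx. destruct (nrm a b ab) as [H|H].
  - left; now apply tree_trans with a.
  - now apply tree_comparable with a.
Qed.

End TreeOrder.

(** * Normal spanning trees as maps to down-sets *)

Definition spanning_order (r : V) (d : V -> list V) : Prop :=
  tree r d /\ (forall v, d v <> []) /\ (forall u v, adj u v -> In u (d v) \/ In v (d u)).

(** The closing edge becomes an inner edge and the edge into [m] closes the cycle. This serves to
    bring a vertex of maximal level to the front. *)
Lemma cycle_rotate (t : V -> V -> Prop) l m l' :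
  is_cycle t (l ++ m :: l') -> is_cycle t (m :: l' ++ l).
Proof.
  intros (Hl & N & C & x & y & Hx & Hy & yx).
  destruct l as [|a l].
  - rewrite app_nil_r. split; [|split; [|split]]; auto. eauto.
  - injection Hx as ->. split; [|split; [|split]].
    + revert Hl. rewrite length_app; simpl. rewrite length_app; simpl; lia.
    + apply Permutation_NoDup with (2 := N). apply Permutation_app_comm.
    + destruct (@exists_last _ (m :: l') ltac:(easy)) as (w & z & E).
      rewrite app_comm_cons, E, <- app_assoc. rewrite E, app_assoc, last_last in Hy.
      subst z. apply chain_app.
      * rewrite <- E. now apply chain_app_r in C.
      * split; auto. now apply chain_app_l in C.
    + destruct (@exists_last _ (x :: l) ltac:(easy)) as (w & z & E).
      exists m, z; split; [easy|]. rewrite E in C |- *. split.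
      * rewrite app_comm_cons, app_assoc. apply last_last.
      * rewrite <- app_assoc in C. apply chain_app_r in C. apply C.
Qed.

Lemma exists_max (f : V -> nat) (l : list V) :
  l <> [] -> exists m, In m l /\ forall x, In x l -> f x <= f m.
Proof.
  induction l as [|a l IH]; [easy|]; intros _.
  destruct l as [|b l].
  - exists a; split; [now left|]. intros x [<-|[]]; auto.
  - destruct IH as (m & Hm & H); [easy|].
    destruct (le_lt_dec (f a) (f m)).
    + exists m; split; [now right|]. intros x [<-|Hx]; auto.
    + exists a; split; [now left|]. intros x [<-|Hx]; auto. specialize (H x Hx); lia.
Qed.

(** The tree edges join each vertex to its parent, so [d v] is the path from [v] down to the
    root. *)
Lemma tree_of_order r d :
  spanning_order r d -> has_normal_spanning_tree adj.
Proof.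
  intros (Hd & tot & nrm).
  pose (t := fun x y => d x = x :: d y \/ d y = y :: d x).
  assert (tsym : forall x y, t x y -> t y x) by (intros x y []; [right|left]; auto).
  assert (tadj : forall x y, t x y -> adj x y).
  { assert (H : forall x y, d x = x :: d y -> adj x y).
    { intros x y E. destruct (proj2 Hd x (tot x)) as [->|(u & xu & _ & E')].
      - rewrite (proj1 Hd) in E. injection E as E. now elim (tot y).
      - replace y with u; auto. apply (tree_inj Hd); auto. congruence. }
    intros x y []; auto. }
  assert (Hr : forall v, is_path t v r (d v)).
  { intros v; generalize (tot v); revert v; apply (tree_ind Hd).
    - rewrite (proj1 Hd); apply path_nil.
    - intros v u vu Hu E IH. rewrite E. apply path_cons with u; auto.
      + now left.
      + assert (N := tree_NoDup Hd v). rewrite E in N. now inversion N. }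
  assert (Hrev : forall v, is_path t r v (rev (d v))).
  { intros v; destruct (Hr v) as (N & C & H & L). repeat split.
    - now apply NoDup_rev.
    - now apply chain_rev.
    - destruct (@exists_last _ (d v) (tot v)) as (w & z & E).
      rewrite E in *. rewrite last_last in L. subst z. now rewrite rev_app_distr.
    - destruct (tree_head Hd v (tot v)) as [l ->]. simpl. apply last_last. }
  exists t, r. split; [split; [exact tadj|split; [exact tsym|split]]|].
  - split; [now exists r|]. intros a b.
    destruct (@reach_path _ t (fun _ => True) a b) as (p & Hp & _); [|now exists p].
    apply reach_trans with r; [|apply reach_sym; auto];
      eapply path_reach; eauto.
  - (* both neighbours on the cycle of a vertex of maximal level would be its parent *)
    intros c Hc.
    destruct (@exists_max (fun v => length (d v)) c) as (m & Hm & Hmax).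
    { destruct Hc as [H _]. now destruct c. }
    apply in_split in Hm as (l & l' & ->).
    apply cycle_rotate in Hc.
    assert (Hmax' : forall x, In x (l' ++ l) -> t m x -> d m = m :: d x).
    { intros x Hx [E|E]; auto. assert (H : length (d x) <= length (d m)).
      { apply Hmax. apply in_app_iff in Hx. apply in_app_iff. simpl; tauto. }
      rewrite E in H; simpl in H; lia. }
    destruct Hc as (Hl & N & C & x & y & E & L & yx). injection E as <-.
    set (w := l' ++ l) in *. clearbody w. inversion_clear N as [|? ? _ N'].
    destruct w as [|z w]; [simpl in Hl; lia|].
    assert (Ey : last (z :: w) m = y) by exact L.
    assert (y = z) as ->.
    { assert (E1 : d m = m :: d y).
      { apply Hmax'; auto. rewrite <- Ey. apply (@last_in _ (z :: w)); easy. }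
      assert (E2 : d m = m :: d z).
      { apply Hmax'; [now left|]. apply C. }
      apply (tree_inj Hd); auto. congruence. }
    destruct w as [|a w]; [simpl in Hl; lia|].
    inversion_clear N' as [|? ? Nz _]. apply Nz. rewrite <- Ey at 1.
    apply (@last_in _ (a :: w)); easy.
  - intros x y xy. destruct (nrm x y xy) as [H|H]; [left|right].
    + exists (rev (d y)); split; auto. now apply in_rev in H.
    + exists (rev (d x)); split; auto. now apply in_rev in H.
Qed.

(** The down-set of [v] is the reversed tree path from [r] to [v]. Without its end [v] this path
    leads to a neighbour [a], and by uniqueness it is [P a]. *)
Lemma order_of_tree :
  has_normal_spanning_tree adj -> exists r d, spanning_order r d.
Proof.
  intros (t & r & (tadj & tsym & tconn & tac) & nrm).
  destruct (choice _ (proj2 tconn r)) as [P HP].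
  assert (uniq : forall v p, is_path t r v p -> p = P v).
  { intros v p Hp. now apply path_unique with (e := t) (a := r) (b := v). }
  exists r, (fun v => rev (P v)). split; [split|split].
  - now rewrite <- (uniq r [r] (path_nil t r)).
  - intros v _. destruct (classic (v = r)) as [|Hv]; auto. right.
    destruct (@exists_last _ (P v)) as (p & z & E).
    { intros E. generalize (path_head_in (HP v)). now rewrite E. }
    assert (z = v) as ->.
    { destruct (HP v) as (_ & _ & _ & L). rewrite E, last_last in L; auto. }
    destruct p as [|a p] using rev_ind.
    { exfalso; apply Hv. destruct (HP v) as (_ & _ & H & _). rewrite E in H. now injection H. }
    clear IHp. exists a.
    assert (Ha : is_path t r a (p ++ [a])).
    { apply path_prefix with (b := v) (l' := [v]).
      replace (p ++ [a; v]) with (P v); auto. now rewrite E, <- app_assoc. }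
    rewrite <- (uniq a _ Ha), E. split; [|split].
    + apply tadj, tsym. destruct (HP v) as (_ & C & _). rewrite E, <- app_assoc in C.
      apply chain_app_r in C. apply C.
    + now rewrite rev_app_distr.
    + now rewrite rev_app_distr.
  - intros v E. generalize (path_head_in (HP v)). rewrite in_rev. now rewrite E.
  - intros u v uv. destruct (nrm u v uv) as [(p & Hp & Hi)|(p & Hp & Hi)]; [left|right];
      apply uniq in Hp; subst p; now apply in_rev in Hi.
Qed.

End Trees.

(** * Levels of a normal spanning tree are dispersed *)

Section Levels.
Variable V : Type.
Variable adj : V -> V -> Prop.
Hypothesis adj_sym : forall x y, adj x y -> adj y x.
Variables (b : nat -> V) (P : nat -> nat -> list V).
Hypothesis b_inj : forall i j, b i = b j -> i = j.
Hypothesis P_path : forall i j, i < j -> is_path adj (b i) (b j) (P i j).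
Hypothesis P_disjoint : forall i j k l x, i < j -> k < l -> (i, j) <> (k, l) ->
  In x (P i j) -> In x (P k l) -> (x = b i \/ x = b j) /\ (x = b k \/ x = b l).

(** By disjointness a vertex other than [b i] lies on at most one of the paths [P i n]. *)
Lemma branch_path_avoids i S :
  ~ In (b i) S ->
  exists N, forall n a, N <= n -> In a S -> i < n -> ~ In a (P i n).
Proof.
  intros Hi. apply (eventually_list (fun n a => i < n -> ~ In a (P i n))).
  intros a Ha. assert (Hab : a <> b i) by (now intros ->).
  destruct (classic (exists k, i < k /\ In a (P i k))) as [(k & ik & Hk)|H].
  - exists (Datatypes.S k); intros n Hn Hin H.
    destruct (@P_disjoint i k i n a) as [[E|E] [E'|E']]; auto; try congruence.
    + injection; lia.
    + rewrite E in E'; apply b_inj in E'; lia.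
  - exists 0; intros n _ Hin Han. apply H; eauto.
Qed.

Lemma branch_reach i j S :
  ~ In (b i) S -> ~ In (b j) S -> reach adj (fun z => ~ In z S) (b i) (b j).
Proof.
  intros Hi Hj.
  destruct (branch_path_avoids _ _ Hi) as [N1 H1].
  destruct (branch_path_avoids _ _ Hj) as [N2 H2].
  pose (n := Datatypes.S (N1 + N2 + i + j)).
  apply reach_trans with (b n).
  - apply path_reach with (P i n); [apply P_path; unfold n; lia|].
    intros z Hz Hs. apply (H1 n z); auto; unfold n; lia.
  - apply reach_sym; auto.
    apply path_reach with (P j n); [apply P_path; unfold n; lia|].
    intros z Hz Hs. apply (H2 n z); auto; unfold n; lia.
Qed.

Lemma branch_fresh (S : list V) : exists i, ~ In (b i) S.
Proof.
  apply NNPP; intros H.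
  assert (I : incl (map b (seq 0 (Datatypes.S (length S)))) S).
  { intros x Hx. apply in_map_iff in Hx as (i & <- & _).
    apply NNPP; intros Hx; apply H; eauto. }
  apply NoDup_incl_length in I.
  - rewrite length_map, length_seq in I; lia.
  - apply NoDup_map_NoDup_ForallPairs; [|apply seq_NoDup].
    intros i j _ _; apply b_inj.
Qed.

Variables (r : V) (d : V -> list V).
Hypothesis Hd : spanning_order adj r d.

(** [tl (d x)] consists of the vertices strictly below [x], and a walk can leave the up-set of [x]
    only through these. *)
Lemma up_reach x a c :
  reach adj (fun z => ~ In z (tl (d x))) a c -> In x (d a) -> In x (d c).
Proof.
  destruct Hd as (Ht & tot & nrm).
  apply (@reach_invariant _ adj _ (fun z => In x (d z))). intros u v uv Hu Hv.
  destruct (tree_up_closed Ht x u v nrm uv Hu) as [H|H]; auto.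
  destruct (tree_head Ht x (tot x)) as [l E]. rewrite E in H, Hv.
  destruct H as [<-|H]; [|now elim Hv]. apply (tree_refl Ht); auto.
Qed.

(** Levels are counted from 1 at the root. In the induction step some branch vertex outside [d x]
    lies above a child [c] of [x]; the other branch vertices outside [d x] are joined to it avoiding
    [d x], the strict down-set of [c], so they lie above [c] too. *)
Lemma branches_comparable n :
  exists x, length (d x) = S n /\ forall i, In (b i) (d x) \/ In x (d (b i)).
Proof.
  destruct Hd as (Ht & tot & nrm).
  induction n as [|n (x & Hx & Hb)].
  - exists r; split; [now rewrite (proj1 Ht)|]. intros i; right. now apply (tree_root Ht).
  - destruct (branch_fresh (d x)) as [i Hi].
    destruct (Hb i) as [H|H]; [contradiction|].
    destruct (tree_child Ht H) as (c & Ec & Hc).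
    { intros E; apply Hi; rewrite E. now apply (tree_refl Ht). }
    exists c; split; [rewrite Ec; simpl; lia|]. intros j.
    destruct (classic (In (b j) (d x))) as [Hj|Hj].
    + left; rewrite Ec; now right.
    + right. apply up_reach with (b i); auto. rewrite Ec. now apply branch_reach.
Qed.

(* A path of the clique that leaves the up-set of [x] must return through [d x], in an inner
   vertex unless both its ends lie in [d x]. By disjointness this happens for finitely many
   paths only; their vertices together with [d x] form the separator. *)
Lemma levels_separated n :
  exists F, separates adj F (fun v => length (d v) = n)
    (fun x => exists i j, i < j /\ In x (P i j)).
Proof.
  destruct Hd as (Ht & tot & nrm).
  destruct (branches_comparable n) as (x & Hx & Hb).
  destruct (@finite_cover V V (fun s y => exists i j, i < j /\ In y (P i j) /\
      In s (P i j) /\ s <> b i /\ s <> b j)) with (L := d x) as [F1 HF1].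
  { intros s.
    destruct (classic (exists i j, i < j /\ In s (P i j) /\ s <> b i /\ s <> b j))
      as [(i & j & ij & Hs & si & sj)|H].
    - exists (P i j). intros y (k & l & kl & Hy & Hs' & sk & sl).
      destruct (classic ((i, j) = (k, l))) as [E|E]; [now injection E as -> ->|].
      destruct (@P_disjoint i j k l s) as [[]]; auto; contradiction.
    - exists []. intros y (k & l & kl & Hy & Hs' & sk & sl). apply H.
      exists k, l; auto. }
  (* A path is indexed by its pair of ends, which determines it as [b] is injective; [F2] takes care
     of the paths with both ends in [d x]. *)
  destruct (@finite_cover V (V * V) (fun s y => exists i j, i < j /\ In y (P i j) /\
      s = (b i, b j))) with (L := list_prod (d x) (d x)) as [F2 HF2].
  { intros s. destruct (classic (exists i j, s = (b i, b j))) as [(i & j & ->)|H].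
    - exists (P i j). intros y (k & l & kl & Hy & E). injection E as E1 E2.
      apply b_inj in E1, E2. now subst.
    - exists []. intros y (k & l & kl & Hy & E). apply H; eauto. }
  exists (d x ++ F1 ++ F2). intros a c p Ha (i & j & ij & Hc) Hp.
  apply NNPP; intros Hno.
  assert (Hpx : forall z, In z p -> ~ In z (d x)).
  { intros z Hz Hzx. apply Hno. exists z; split; auto. apply in_or_app; auto. }
  assert (cp : In c p) by (eapply path_last_in; eauto).
  assert (tlx : forall z, In z (tl (d x)) -> In z (d x)).
  { intros z Hz. destruct (d x); [easy|now right]. }
  (* As [p] avoids [d x], with [c] also [a] would be above [x]; but [x] has level [n + 1] and [a]
     only [n]. *)
  assert (Hcx : ~ In x (d c)).
  { intros H. assert (Hxa : In x (d a)).
    { apply up_reach with c; auto. apply reach_sym; auto.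
      apply path_reach with p; auto. intros z Hz Hz'. apply (Hpx z); auto. }
    destruct (tree_suffix Ht _ _ Hxa) as [_ [l E]].
    apply (f_equal (@length V)) in E. rewrite length_app in E. lia. }
  assert (Hin : forall s, In s (P i j) -> In s (d x) -> s = b i \/ s = b j).
  { intros s Hs Hsx. apply NNPP; intros E. apply Hno. exists c; split; auto.
    apply in_or_app; right. apply in_or_app; left. apply (HF1 s); auto.
    exists i, j; tauto. }
  assert (Hends : ~ (In (b i) (d x) /\ In (b j) (d x))).
  { intros [H1 H2]. apply Hno. exists c; split; auto.
    apply in_or_app; right. apply in_or_app; right. apply (HF2 (b i, b j)).
    - now apply in_prod.
    - exists i, j; auto. }
  assert (PP := P_path ij).
  apply in_split in Hc as (l & l' & E). rewrite E in PP.
  assert (cdx : ~ In c (d x)) by auto.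
  assert (N : NoDup (l ++ c :: l')) by apply PP.
  (* One end of [P i j] is outside [d x], hence above [x]. From there to [c] the path avoids [d x],
     since [NoDup] excludes the other end; so [c] is above [x], a contradiction. *)
  destruct (classic (In (b j) (d x))) as [Hj|Hj].
  - destruct (Hb i) as [Hi|Hi]; [tauto|].
    apply Hcx. apply up_reach with (b i); auto.
    apply path_reach with (l ++ [c]); [now apply path_prefix in PP|].
    intros z Hz Hzx. apply tlx in Hzx.
    apply in_app_iff in Hz as [Hz|[<-|[]]]; [|contradiction].
    destruct (Hin z) as [->| ->]; auto.
    + rewrite E. apply in_or_app; now left.
    + apply path_suffix in PP. apply path_last_in in PP.
      now apply (NoDup_app_disjoint _ _ N (b j)).
  - destruct (Hb j) as [Hj'|Hj']; [tauto|].
    apply Hcx. apply up_reach with (b j); auto. apply reach_sym; auto.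
    apply path_reach with (c :: l'); [now apply path_suffix in PP|].
    intros z Hz Hzx. apply tlx in Hzx.
    destruct Hz as [<-|Hz]; [contradiction|].
    destruct (Hin z) as [->| ->]; auto.
    + rewrite E. apply in_or_app; right; now right.
    + apply path_prefix in PP. apply path_head_in in PP.
      change (c :: l') with ([c] ++ l') in N. rewrite app_assoc in N.
      now apply (NoDup_app_disjoint _ _ N (b i)).
Qed.

End Levels.

(** * Growing a normal tree into the components of its complement *)

Section Extension.
Variable V : Type.
Variable adj : V -> V -> Prop.
Hypothesis adj_sym : forall x y, adj x y -> adj y x.
Variable r : V.

Definition component (d : V -> list V) (v : V) : V -> Prop :=
  reach adj (fun z => d z = []) v.

Lemma component_eq d u v : component d u v -> component d u = component d v.
Proof.
  intros H. apply functional_extensionality; intros w. apply propositional_extensionality.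
  split; intros Hw.
  - apply reach_trans with u; auto. now apply reach_sym.
  - now apply reach_trans with v.
Qed.

(** The tree neighbours of [D] then form a finite chain, so that for a component [D] a path hung
    from [t] keeps adjacent tree vertices comparable. *)
Definition top_neighbour (d : V -> list V) (D : V -> Prop) (t : V) : Prop :=
  d t <> [] /\ (exists y, D y /\ adj y t) /\
  forall y x, D y -> d x <> [] -> adj y x -> In x (d t).

Definition normal_tree (d : V -> list V) : Prop :=
  tree adj r d /\
  (forall u v, d u <> [] -> d v <> [] -> adj u v -> In u (d v) \/ In v (d u)) /\
  forall v, d v = [] -> exists t, top_neighbour d (component d v) t.

(* [Q] lists, from top to bottom, a path to be grown in [D] from the tree vertex [t]. *)
Definition branch (d : V -> list V) (A D : V -> Prop) (Q : list V) (t : V) : Prop :=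
  top_neighbour d D t /\ Q <> [] /\ NoDup Q /\ (forall q, In q Q -> D q) /\
  chain adj (Q ++ [t]) /\ ((exists a, D a /\ A a) -> exists a, In a Q /\ A a).

Lemma branch_exists d A v :
  normal_tree d -> d v = [] -> exists Q t, branch d A (component d v) Q t.
Proof.
  intros (_ & _ & Htop) Hv. destruct (Htop v Hv) as [t Ht].
  destruct (proj1 (proj2 Ht)) as (y & Hy & yt).
  (* The path will start at a vertex of [A] if the component has one, and otherwise at [y]
     itself. *)
  assert (Ha : exists a, component d v a /\ ((exists a, component d v a /\ A a) -> A a)).
  { destruct (classic (exists a, component d v a /\ A a)) as [(a & ? & ?)|]; [exists a|exists y];
      tauto. }
  destruct Ha as (a & va & Aa).
  assert (R : reach adj (fun z => d z = []) a y).
  { apply reach_trans with v; auto. now apply reach_sym. }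
  destruct (reach_path R) as (p & Hp & Hpd).
  exists p, t. split; [exact Ht|]. pose proof Hp as (N & C & Hh & L).
  assert (p <> []) as Hne by (intros ->; easy).
  split; [exact Hne|]. split; [exact N|]. split; [|split].
  - intros q Hq. apply reach_trans with a; auto.
    destruct (path_inv Hp) as [l ->]. now apply chain_reach with l.
  - destruct (exists_last Hne) as (w & z & ->). rewrite last_last in L. subst z.
    rewrite <- app_assoc. apply chain_app; auto. now split.
  - intros H. exists a; split; auto. now apply path_head_in in Hp.
Qed.

Fixpoint suffix_from (v : V) (l : list V) : list V :=
  match l with
  | [] => []
  | x :: l' => if excluded_middle_informative (x = v) then l else suffix_from v l'
  end.

Lemma suffix_from_notin v l : ~ In v l -> suffix_from v l = [].
Proof.
  induction l as [|x l IH]; simpl; auto; intros H.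
  destruct (excluded_middle_informative (x = v)); tauto.
Qed.

Lemma suffix_from_app v l l' :
  ~ In v l -> suffix_from v (l ++ v :: l') = v :: l'.
Proof.
  induction l as [|x l IH]; simpl; intros H;
    destruct (excluded_middle_informative _); tauto.
Qed.

Lemma suffix_from_comparable u v l l' :
  In u l -> In v l ->
  In u (suffix_from v (l ++ l')) \/ In v (suffix_from u (l ++ l')).
Proof.
  induction l as [|x l IH]; [easy|]. simpl.
  destruct (excluded_middle_informative (x = v)) as [->|nv].
  - intros Hu _. left. change (In u ((v :: l) ++ l')). apply in_or_app; now left.
  - destruct (excluded_middle_informative (x = u)) as [->|nu].
    + intros _ Hv. right. change (In v ((u :: l) ++ l')). apply in_or_app; now left.
    + intros [|Hu] [|Hv]; try contradiction; auto.
Qed.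

(** The down-set of [t] is appended so that the down-set of each vertex of the branch is a suffix of
    this list. *)
Definition chosen_branch (d : V -> list V) (A D : V -> Prop) : list V :=
  epsilon (inhabits []) (fun L => exists Q t, L = Q ++ d t /\ branch d A D Q t).

(* Since the chosen branch depends on the component only, all its vertices agree on it. *)
Definition extend (A : V -> Prop) (d : V -> list V) (v : V) : list V :=
  match d v with
  | [] => suffix_from v (chosen_branch d A (component d v))
  | l => l
  end.

Section Step.
Variables (A : V -> Prop) (d : V -> list V).
Hypothesis Hd : normal_tree d.
Let d' := extend A d.

Lemma extend_old v : d v <> [] -> d' v = d v.
Proof. unfold d', extend; now destruct (d v). Qed.

Lemma extend_nil v : d' v = [] -> d v = [].
Proof. unfold d', extend; now destruct (d v). Qed.

Lemma extend_branch v : d v = [] ->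
  exists Q t, branch d A (component d v) Q t /\
    (forall q, In q Q <-> component d v q /\ d' q <> []) /\
    (forall q, In q Q -> d' q = suffix_from q (Q ++ d t)).
Proof.
  intros Hv.
  destruct (branch_exists A v Hd Hv) as (Q0 & t0 & H0).
  assert (H : exists Q t, chosen_branch d A (component d v) = Q ++ d t /\
                     branch d A (component d v) Q t).
  { apply (epsilon_spec (inhabits [])
      (fun L => exists Q t, L = Q ++ d t /\ branch d A (component d v) Q t)).
    exists (Q0 ++ d t0), Q0, t0; auto. }
  destruct H as (Q & t & E & HQ). exists Q, t; split; auto.
  assert (Eq : forall q, component d v q -> d' q = suffix_from q (Q ++ d t)).
  { intros q Hq. unfold d', extend. rewrite (reach_right Hq).
    now rewrite <- (component_eq Hq), E. }
  assert (HQD : forall q, In q Q -> component d v q) by apply HQ.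
  split; auto. intros q; split.
  - intros Hq; split; auto. rewrite Eq; auto.
    destruct (suffix_from_comparable q q Q (d t) Hq Hq) as [H|H]; now intros E'; rewrite E' in H.
  - intros [Hq Hne]. apply NNPP; intros Hn. apply Hne. rewrite Eq; auto.
    apply suffix_from_notin. intros H. apply in_app_iff in H as [H|H]; auto.
    destruct (tree_suffix (proj1 Hd) _ _ H) as [H' _]. apply H'. now apply reach_right in Hq.
Qed.

Lemma component_extend v w : component d' v w -> component d v w.
Proof. apply reach_sub. exact extend_nil. Qed.

(** A walk from [v] to the branch inside the old component enters the new tree by an edge from the
    new component of [v]. *)
Lemma extend_meets_branch v :
  d' v = [] -> exists y q, component d' v y /\ adj y q /\ component d v q /\ d' q <> [].
Proof.
  intros Hv. destruct (extend_branch (extend_nil _ Hv)) as (Q & t & HB & HQ & _).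
  destruct HB as (_ & Hne & _).
  destruct Q as [|q Q]; [easy|].
  destruct (proj1 (HQ q) (or_introl eq_refl)) as [vq Hq].
  destruct (reach_exit (fun z => d' z = []) vq Hv Hq) as (y & z & R & yz & dz & dz').
  exists y, z. repeat split; auto.
  - revert R; apply reach_sub; tauto.
  - apply reach_snoc with y; auto. revert R; apply reach_sub; tauto.
Qed.

(** An edge between new vertices stays in one component, hence in one branch, which is a chain; an
    edge from a new vertex to the old tree ends below [t]. A new component has its neighbours on the
    branch of the old component around it or below [t], so its topmost neighbour on that branch is
    the largest. *)
Lemma extend_normal : normal_tree d'.
Proof.
  destruct Hd as (Ht & Hn & Htop).
  assert (dne : forall v, d v <> [] -> d' v <> []) by (intros v Hv; now rewrite extend_old).
  assert (Hlow : forall v Q t, (forall q, In q Q -> d' q = suffix_from q (Q ++ d t)) ->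
     In v Q -> exists l l', Q = l ++ v :: l' /\ ~ In v l /\ d' v = v :: l' ++ d t).
  { intros v Q t H Hv. rewrite H; auto. clear H.
    induction Q as [|x Q IH]; [easy|].
    destruct (classic (x = v)) as [->|xv].
    - exists [], Q; split; auto; split; auto. exact (@suffix_from_app v [] (Q ++ d t) (fun H => H)).
    - destruct Hv as [|Hv]; [contradiction|].
      destruct (IH Hv) as (l & l' & -> & Hl & E). exists (x :: l), l'; split; auto.
      split; [intros []; contradiction|]. rewrite <- E. simpl.
      destruct (excluded_middle_informative (x = v)); tauto. }
  split; [split|split].
  - unfold d'. rewrite extend_old; [apply Ht|]. now rewrite (proj1 Ht).
  - intros v Hv. destruct (classic (d v = [])) as [dv|dv].
    + right. destruct (extend_branch dv) as (Q & t & HB & HQ & EQ).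
      assert (vQ : In v Q) by (apply HQ; split; auto; now apply reach_refl).
      destruct (Hlow v Q t EQ vQ) as (l & l' & E & Hl & Ev).
      destruct HB as (Htn & _ & N & _ & C & _).
      rewrite E, <- app_assoc in C. apply chain_app_r in C.
      destruct l' as [|u l'].
      * exists t. split; [apply C|]. destruct Htn as (dt & _). split; auto.
        rewrite (extend_old dt); auto.
      * exists u. split; [apply C|].
        assert (uQ : In u Q) by (rewrite E; apply in_or_app; right; right; now left).
        split; [now apply HQ|]. rewrite Ev. f_equal. rewrite EQ; auto.
        replace (Q ++ d t) with ((l ++ [v]) ++ u :: l' ++ d t)
          by (rewrite E; now rewrite <- !app_assoc).
        rewrite suffix_from_app; auto. intros Hu.
        rewrite E in N. replace (l ++ v :: u :: l') with ((l ++ [v]) ++ u :: l') in N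
          by (now rewrite <- app_assoc).
        apply NoDup_remove_2 in N. apply N. apply in_or_app; now left.
    + destruct (proj2 Ht v dv) as [|(u & vu & du & E)]; auto. right.
      exists u. rewrite !extend_old; auto.
  - assert (H1 : forall u v, d' u <> [] -> d u = [] -> d v <> [] -> adj u v -> In v (d' u)).
    { intros u v Hu du dv uv. destruct (extend_branch du) as (Q & t & HB & HQ & EQ).
      assert (uu : component d u u) by now apply reach_refl.
      assert (uQ : In u Q) by (now apply HQ).
      destruct (Hlow u Q t EQ uQ) as (l & l' & _ & _ & ->).
      right. apply in_or_app; right. destruct HB as ((_ & _ & H) & _). now apply H with u. }
    intros u v Hu Hv uv.
    destruct (classic (d u = [])) as [du|du], (classic (d v = [])) as [dv|dv]; auto.
    + destruct (extend_branch du) as (Q & t & _ & HQ & EQ).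
      assert (uu : component d u u) by now apply reach_refl.
      assert (uQ : In u Q) by (now apply HQ).
      assert (vQ : In v Q) by (apply HQ; split; auto; now apply reach_snoc with u).
      rewrite !EQ; auto. now apply suffix_from_comparable.
    + rewrite !extend_old; auto.
  - intros v Hv. destruct (extend_branch (extend_nil _ Hv)) as (Q & t & HB & HQ & EQ).
    pose (N := fun q => In q Q /\ exists y, component d' v y /\ adj y q).
    destruct (extend_meets_branch v Hv) as (y0 & q0 & vy0 & yq0 & vq0 & Hq0).
    assert (Hq : exists q, N q /\ forall x, N x -> In x (d' q)).
    { assert (q0Q : N q0) by (split; [now apply HQ|eauto]).
      (* [Q] is searched from the top: the first vertex in [N] has the rest of [Q] below it, and so
         all of [N]. *)
      assert (H : forall l l', Q = l ++ l' -> (forall x, In x l -> ~ N x) ->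
         (exists x, In x l' /\ N x) -> exists q, N q /\ forall x, N x -> In x (d' q)).
      { intros l l'; revert l; induction l' as [|q l' IH]; intros l E Hl (x & Hx & Nx); [easy|].
        destruct (classic (N q)) as [Nq|Nq].
        - exists q; split; auto. intros z Nz. rewrite EQ by apply Nq.
          rewrite E, <- app_assoc; simpl. rewrite suffix_from_app; [|intros H; now apply (Hl q)].
          assert (zQ : In z Q) by apply Nz. rewrite E in zQ.
          apply in_app_iff in zQ as [zl|zl]; [now elim (Hl z zl)|].
          change (In z ((q :: l') ++ d t)). apply in_or_app; now left.
        - apply (IH (l ++ [q])).
          + now rewrite <- app_assoc.
          + intros z Hz. apply in_app_iff in Hz as [Hz|[<-|[]]]; auto.
          + exists x; split; auto. destruct Hx as [<-|]; tauto. }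
      apply (H [] Q); auto. exists q0; split; auto. apply q0Q. }
    destruct Hq as (q & Nq & Hmax). exists q. destruct Nq as [qQ Hqy].
    split; [now apply HQ|]. split; [exact Hqy|].
    intros y x vy Hx yx. destruct (classic (d x = [])) as [dx|dx].
    + apply Hmax. split; [|eauto]. apply HQ; split; auto.
      apply reach_snoc with y; auto. now apply component_extend.
    + destruct (Hlow q Q t EQ qQ) as (l & l' & _ & _ & ->).
      right. apply in_or_app; right. destruct HB as ((_ & _ & H) & _).
      apply H with y; auto. now apply component_extend.
Qed.

End Step.
End Extension.

(** * The increasing sequence of normal trees *)

Section Construction.
Variable V : Type.
Variable adj : V -> V -> Prop.
Hypothesis adj_sym : forall x y, adj x y -> adj y x.
Hypothesis G_conn : connected adj.
Variable r : V.
Variable Vn : nat -> V -> Prop.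

(* Each [m] is the first component of [of_nat n] for infinitely many [n], so every set [Vn k]
   and every level of the tree is aimed at infinitely often. *)
Definition target (n : nat) (d : V -> list V) (a : V) : Prop :=
  let m := fst (of_nat n) in
  if Nat.even m then Vn (Nat.div2 m) a
  else exists x, adj a x /\ d x <> [] /\ length (d x) = Nat.div2 m.

Lemma of_nat_fst_unbounded m N : exists n, N <= n /\ fst (of_nat n) = m.
Proof.
  exists (to_nat (m, N)). rewrite cancel_of_to; split; auto.
  generalize (to_nat_non_decreasing m N); lia.
Qed.

Fixpoint stage (n : nat) : V -> list V :=
  match n with
  | O => fun v => if excluded_middle_informative (v = r) then [r] else []
  | S n => extend adj (target n (stage n)) (stage n)
  end.

Lemma stage0_dom v : stage 0 v <> [] -> v = r.
Proof. simpl; now destruct (excluded_middle_informative (v = r)). Qed.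

Lemma stage0_root : stage 0 r = [r].
Proof. simpl; now destruct (excluded_middle_informative (r = r)). Qed.

Lemma stage_normal n : normal_tree adj r (stage n).
Proof.
  induction n as [|n IH]; [|now apply extend_normal].
  split; [split|split].
  - exact stage0_root.
  - intros v Hv; left; now apply stage0_dom.
  - intros u v Hu Hv _. apply stage0_dom in Hu, Hv. subst. left.
    rewrite stage0_root; now left.
  - intros v Hv. exists r. assert (Hr := stage0_root). split; [congruence|]. split.
    + destruct (proj2 G_conn v r) as [p Hp].
      assert (R : reach adj (fun _ => True) v r) by (eapply path_reach; eauto).
      destruct (reach_exit (fun z => stage 0 z = []) R Hv) as (y & z & vy & yz & _ & Hz);
        [congruence|].
      exists y; split.
      * revert vy; apply reach_sub; tauto.
      * apply stage0_dom in Hz; now subst.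
    + intros y x _ Hx _. apply stage0_dom in Hx; subst. rewrite Hr; now left.
Qed.

Lemma stage_mono n m v : n <= m -> stage n v <> [] -> stage m v = stage n v.
Proof.
  induction 1 as [|m _ IH]; auto; intros Hv.
  rewrite <- IH; auto. simpl. apply extend_old. rewrite IH; auto.
Qed.

(** * A vertex [c] that no stage reaches *)

Section Uncovered.
Variable c : V.
Hypothesis Hc : forall n, stage n c = [].

(** The vertex set of the path [P_n] that step [n] adds in the component of [c]. *)
Definition grown (n : nat) (q : V) : Prop :=
  component adj (stage n) c q /\ stage (S n) q <> [].

Lemma grown_branch n :
  exists Q t, branch adj (stage n) (target n (stage n)) (component adj (stage n) c) Q t /\
    forall q, In q Q <-> grown n q.
Proof.
  destruct (extend_branch adj_sym (target n (stage n)) (stage_normal n) c (Hc n))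
    as (Q & t & HB & HQ & _).
  exists Q, t; auto.
Qed.

Lemma grown_nonempty n : exists q, grown n q.
Proof.
  destruct (grown_branch n) as ([|q Q] & t & (_ & Hne & _) & HQ); [easy|].
  exists q; apply HQ; now left.
Qed.

(** A vertex that is in the tree at some stage lies on no path grown later. *)
Lemma grown_avoids F : exists N, forall n q, N <= n -> In q F -> ~ grown n q.
Proof.
  apply (eventually_list (fun n q => ~ grown n q)). intros q _.
  destruct (classic (exists m, stage m q <> [])) as [[m Hm]|H].
  - exists m; intros n Hn [Hq _]. apply reach_right in Hq.
    now rewrite (stage_mono _ Hn Hm) in Hq.
  - exists 0; intros n _ [_ Hq]; eauto.
Qed.

Lemma grown_connected n q q' : grown n q -> grown n q' -> reach adj (grown n) q q'.
Proof.
  intros Hq Hq'. destruct (grown_branch n) as ([|q0 Q] & t & HB & HQ);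
    [now elim (proj2 (HQ q) Hq)|].
  destruct HB as (_ & _ & _ & _ & C & _). apply chain_app_l in C.
  assert (H : forall z, grown n z -> reach adj (grown n) q0 z).
  { intros z Hz. apply chain_reach with Q; auto; [|now apply HQ]. intros w; apply HQ. }
  apply reach_trans with q0; auto. apply reach_sym; auto.
Qed.

(** The path of step [n + 1] hangs from the largest neighbour [t] of the component of [c]. This
    component also has a neighbour [q] on the path of step [n], and [q] is below [t]; were [t]
    already in stage [n], so would be [q]. *)
Lemma grown_linked n : exists q q', grown n q /\ grown (S n) q' /\ adj q q'.
Proof.
  destruct (grown_branch (S n)) as (Q & t & HB & HQ).
  destruct HB as ((Ht & (y & cy & yt) & Htop) & Hne & _ & _ & C & _).
  destruct (exists_last Hne) as (Q' & q' & ->).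
  rewrite <- app_assoc in C. apply chain_app_r in C. destruct C as [q't _].
  exists t, q'. split; [|split; auto; apply HQ; apply in_or_app; right; now left].
  split; auto.
  assert (dt : stage n t = []).
  { apply NNPP; intros dt.
    destruct (extend_meets_branch adj_sym (target n (stage n)) (stage_normal n) c (Hc (S n)))
      as (z & q & cz & zq & cq & Hq).
    assert (qt : In q (stage (S n) t)) by now apply Htop with z.
    rewrite (stage_mono t (le_S _ _ (le_n n)) dt) in qt.
    destruct (tree_suffix (proj1 (stage_normal n)) _ _ qt) as [H _].
    apply H. now apply reach_right in cq. }
  apply reach_snoc with y; auto. now apply component_extend in cy.
Qed.

Lemma grown_reach (F : list V) N m n q q' :
  (forall n q, N <= n -> In q F -> ~ grown n q) ->
  N <= m -> N <= n -> grown m q -> grown n q' -> reach adj (fun z => ~ In z F) q q'.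
Proof.
  intros HN.
  assert (H1 : forall n q q', N <= n -> grown n q -> grown n q' ->
     reach adj (fun z => ~ In z F) q q').
  { clear m n q q'; intros n q q' Hn Hq Hq'.
    apply reach_sub with (grown n); [|now apply grown_connected].
    intros z Hz HF. now apply (HN n z). }
  assert (H2 : forall k m q q', N <= m -> grown m q -> grown (k + m) q' ->
     reach adj (fun z => ~ In z F) q q').
  { clear m n q q'; induction k as [|k IH]; intros m q q' Hm Hq Hq'; [now apply H1 with m|].
    destruct (grown_linked (k + m)) as (z & z' & Hz & Hz' & zz').
    apply reach_trans with z'; [|apply H1 with (S k + m); auto; lia].
    apply reach_snoc with z; auto; [now apply (IH m)|].
    intros HF. apply (HN (S k + m) z'); auto; lia. }
  intros Hm Hn Hq Hq'. destruct (le_ge_dec m n) as [H|H].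
  - apply (H2 (n - m) m); auto. now replace (n - m + m) with n by lia.
  - apply reach_sym; auto. apply (H2 (m - n) n); auto. now replace (m - n + n) with m by lia.
Qed.

(** The neighbourhood of the component of [c] in the complement of the union of all stages. *)
Definition boundary (x : V) : Prop :=
  (exists n, stage n x <> []) /\
  exists y, reach adj (fun z => forall n, stage n z = []) c y /\ adj y x.

(** Otherwise some stage [N] contains the whole boundary. But a walk outside stage [N] from [c] to
    the path of step [N] leaves the surviving component through a boundary vertex. *)
Lemma boundary_infinite (l : list V) : exists x, boundary x /\ ~ In x l.
Proof.
  apply NNPP; intros H.
  destruct (eventually_list (fun n x => boundary x -> stage n x <> []) l) as [N HN].
  { intros x _. destruct (classic (boundary x)) as [Hx|Hx]; [|now exists 0].
    destruct Hx as [[n Hn] _]. exists n; intros k Hk _. now rewrite (stage_mono _ Hk Hn). }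
  destruct (grown_nonempty N) as (q & cq & Hq).
  destruct (reach_exit (fun z => forall n, stage n z = []) cq Hc) as (y & z & cy & yz & Hz & Hz').
  { intros H'; now apply Hq. }
  assert (bz : boundary z).
  { split.
    - now apply not_all_ex_not.
    - exists y; split; auto. revert cy; apply reach_sub; tauto. }
  apply (HN N z); auto. apply NNPP; intros Hl; apply H; eauto.
Qed.

Lemma grown_target n :
  (exists a, component adj (stage n) c a /\ target n (stage n) a) ->
  exists a, grown n a /\ target n (stage n) a.
Proof.
  intros H. destruct (grown_branch n) as (Q & t & HB & HQ).
  destruct HB as (_ & _ & _ & _ & _ & HA). destruct (HA H) as (a & aQ & Ha).
  exists a; split; auto. now apply HQ.
Qed.

(** A step aiming at the level of [x] reaches a neighbour of a tree vertex [x'] of that level. Both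
    [x] and [x'] are neighbours of the component of [c], hence below its largest neighbour [t], and
    so they are equal. *)
Lemma boundary_adjacent x N : boundary x -> exists n q, N <= n /\ grown n q /\ adj q x.
Proof.
  intros [[n0 Hx] (y & cy & yx)].
  (* An odd code selects a level; the bound [N + n0] ensures that [x] is already in the tree. *)
  destruct (of_nat_fst_unbounded (S (2 * length (stage n0 x))) (N + n0)) as (n & Hn & E).
  assert (Hn0 : n0 <= n) by lia.
  assert (Ex := stage_mono x Hn0 Hx).
  assert (cny : component adj (stage n) c y) by (revert cy; now apply reach_sub).
  assert (Htgt : forall a, target n (stage n) a <-> exists x', adj a x' /\ stage n x' <> [] /\
     length (stage n x') = length (stage n x)).
  { intros a; unfold target. rewrite E, Nat.even_succ, Nat.odd_mul, Nat.div2_succ_double, Ex.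
    reflexivity. }
  destruct (grown_target n) as (a & Ha & Ta).
  { exists y; split; auto. apply Htgt. exists x; repeat split; auto; congruence. }
  apply Htgt in Ta as (x' & ax' & Hx' & El).
  exists n, a. split; [lia|]. split; auto. replace x with x'; auto.
  destruct (grown_branch n) as (_ & t & ((_ & _ & Htop) & _) & _).
  apply (tree_level_inj (proj1 (stage_normal n))) with (v := t); auto.
  - apply Htop with a; auto. apply Ha.
  - apply Htop with y; auto. congruence.
Qed.

(** An even code selects [Vn k], and [c] itself witnesses that the component contains a target. *)
Lemma grown_meets k N : Vn k c -> exists n q, N <= n /\ grown n q /\ Vn k q.
Proof.
  intros Hk. destruct (of_nat_fst_unbounded (2 * k) N) as (n & Hn & E).
  assert (Htgt : forall a, target n (stage n) a <-> Vn k a).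
  { intros a; unfold target. rewrite E, Nat.even_mul, Nat.div2_double. reflexivity. }
  destruct (grown_target n) as (a & Ha & Ta).
  { exists c; split; [now apply reach_refl|now apply Htgt]. }
  exists n, a; repeat split; auto; try apply Ha. now apply Htgt.
Qed.

Lemma uncovered_not_dispersed k : Vn k c -> ~ TK_dispersed adj (Vn k).
Proof.
  intros Hk disp.
  destruct (@infinitely_connected_clique V adj boundary) as (K & b & HK & binj & Hb).
  - exact boundary_infinite.
  - intros x y S Hx Hy xy.
    destruct (grown_avoids S) as [N HN].
    destruct (boundary_adjacent N Hx) as (m & q & Hm & Hq & qx).
    destruct (boundary_adjacent N Hy) as (n & q' & Hn & Hq' & qy).
    apply reach_path. apply reach_cons with q; auto. apply reach_snoc with q'; auto.
    apply reach_sub with (fun z => ~ In z S); [tauto|].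
    now apply grown_reach with N m n.
  (* [F] misses some [b i] and all late grown paths; these are linked and contain a vertex of [Vn k]
     as well as a neighbour of [b i]. *)
  - destruct (disp K HK) as [F HF].
    destruct (branch_fresh b binj F) as [i Hi].
    destruct (grown_avoids F) as [N HN].
    destruct (boundary_adjacent N (proj1 (Hb i))) as (m & q & Hm & Hq & qx).
    destruct (grown_meets N Hk) as (n & q' & Hn & Hq' & Vq').
    destruct (@reach_path _ adj (fun z => ~ In z F) q' (b i)) as (p & Hp & Hpf).
    { apply reach_snoc with q; auto. now apply grown_reach with N n m. }
    destruct (HF q' (b i) p Vq' (proj2 (Hb i)) Hp) as (f & Hf & Hfp).
    now apply (Hpf f).
Qed.

End Uncovered.

(** Every vertex enters some stage, and a down-set never changes afterwards; [d] is the union of the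
    stages. *)
Lemma spanning_order_of_dispersed :
  (forall v, exists n, Vn n v) -> (forall n, TK_dispersed adj (Vn n)) ->
  exists d, spanning_order adj r d.
Proof.
  intros cover disp.
  assert (tot : forall v, exists n, stage n v <> []).
  { intros v. apply NNPP; intros H. destruct (cover v) as [k Hk].
    apply (@uncovered_not_dispersed v) with k; auto.
    intros n; apply NNPP; intros Hn; eauto. }
  destruct (choice _ tot) as [h Hh].
  pose (d := fun v => stage (h v) v).
  assert (dE : forall n v, stage n v <> [] -> stage n v = d v).
  { intros n v Hv. destruct (le_ge_dec n (h v)) as [H|H].
    - symmetry; now apply stage_mono.
    - now apply stage_mono. }
  exists d. split; [split|split; auto].
  - rewrite <- (dE 0); rewrite stage0_root; easy.
  - intros v _.
    destruct (proj2 (proj1 (stage_normal (h v))) v (Hh v)) as [|(u & vu & Hu & E)]; auto.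
    right; exists u. split; auto. split; [apply Hh|]. unfold d at 1. rewrite E. f_equal; auto.
  - intros u v uv.
    pose (n := h u + h v).
    assert (Eu : stage n u = d u) by (apply stage_mono; auto; unfold n; lia).
    assert (Ev : stage n v = d v) by (apply stage_mono; auto; unfold n; lia).
    rewrite <- Eu, <- Ev. apply (stage_normal n); auto; rewrite ?Eu, ?Ev; apply Hh.
Qed.

End Construction.

Theorem theorem3 (V : Type) (adj : V -> V -> Prop)
  (adj_sym : forall x y, adj x y -> adj y x)
  (adj_irrefl : forall x, ~ adj x x)
  (G_conn : connected adj) :
  has_normal_spanning_tree adj <->
  exists Vn : nat -> V -> Prop,
    (forall v, exists n, Vn n v) /\
    (forall n, TK_dispersed adj (Vn n)).
Proof.
  split.
  - intros H. destruct (order_of_tree H) as (r & d & Hd).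
    (* The dispersed sets are the levels of the tree; level 0 is empty. *)
    exists (fun n v => length (d v) = n). split; [eauto|].
    intros n K (b & P & b_inj & P_path & _ & P_dis & HK).
    destruct (levels_separated adj_sym b P b_inj P_path P_dis Hd n) as [F HF].
    exists F. intros a c p Ha Hc. apply HF; auto. now apply HK.
  - intros (Vn & cover & disp). destruct (proj1 G_conn) as [r _].
    destruct (spanning_order_of_dispersed adj_sym G_conn r Vn cover disp) as [d Hd].
    now apply tree_of_order with r d.
Qed.
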